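(* Let $b>a>0$ and $0\leq\rho<\frac12<\theta\leq1$. Then there are constants $C,c>0$ such that the solution $W=W(t,\xi)$ of $$W_t+\left(\tfrac12B_0|\xi|^{2\rho}+iB_1|\xi|+\tfrac12B_0|\xi|^{2\theta}\right)W=0\quad(\xi\in\mathbb{R}^2,\ t>0),\qquad W(0,\xi)=W_0(\xi),$$ satisfies, for all $\xi\in\mathbb{R}^2$ and $t\geq0$, $$|W(t,\xi)|\leq C e^{-c\,\eta(|\xi|)t}|W_0(\xi)|,\qquad\text{where}\quad \eta(|\xi|):=\frac{|\xi|^{2-2\rho}}{1+|\xi|^{2\theta-2\rho}}.$$
   Context: $W$ takes values in $\mathbb{C}^4$, and $$B_0=\begin{pmatrix}1&0&1&0\\0&1&0&1\\1&0&1&0\\0&1&0&1\end{pmatrix},\qquad B_1=\operatorname{diag}(-b,-a,b,a).$$ The constants $C,c$ do not depend on $t$, $\xi$ or $W_0$. *)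

(* Defs.v *)
From HB Require Import structures.
From mathcomp Require Import all_boot all_order all_algebra.
From mathcomp Require Import all_classical all_reals all_analysis.
From mathcomp Require Export complex.

Set Implicit Arguments.
Unset Strict Implicit.
Unset Printing Implicit Defensive.

Import Order.TTheory GRing.Theory Num.Theory.
Import numFieldNormedType.Exports.

Local Open Scope classical_set_scope.
Local Open Scope ring_scope.
Local Open Scope complex_scope.

(* The library norm on matrices is the sup norm, hence the explicit Euclidean
   (resp. Hermitian) norms. *)
Definition enorm (R : realType) (n : nat) (x : 'rV[R]_n) : R :=
  Num.sqrt (\sum_(i < n) x 0 i ^+ 2).

Definition hnorm (R : realType) (n : nat) (v : 'cV[R[i]]_n) : R :=
  Num.sqrt (\sum_(i < n) (complex.Re (v i 0) ^+ 2 + complex.Im (v i 0) ^+ 2)).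

Definition B0 (R : realType) : 'M[R[i]]_4 :=
  \matrix_(i < 4, j < 4)
    (nth 0 (nth [::] [:: [:: 1; 0; 1; 0];
                         [:: 0; 1; 0; 1];
                         [:: 1; 0; 1; 0];
                         [:: 0; 1; 0; 1]] i) j)%:C.

Definition B1 (R : realType) (a b : R) : 'M[R[i]]_4 :=
  diag_mx (\row_(j < 4) (nth 0 [:: - b; - a; b; a] j)%:C).

(* [r `^ x] satisfies [0 `^ 0 = 1] and [0 `^ x = 0] for [x != 0]. *)
Definition symbol (R : realType) (a b rho theta : R) (xi : 'rV[R]_2) :
    'M[R[i]]_4 :=
  (2^-1 * enorm xi `^ (2 * rho))%:C *: B0 R
  + ('i%C * (enorm xi)%:C) *: B1 a b
  + (2^-1 * enorm xi `^ (2 * theta))%:C *: B0 R.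

(* [R[i]] is not a normed module over [R] in the library, so functions of a
   real variable with values in [C^n] are differentiated, and their limits are
   taken, componentwise on real and imaginary parts. *)
Definition cderivable (R : realType) (n : nat) (f : R -> 'cV[R[i]]_n) (t : R) :
    Prop :=
  forall i, derivable (fun s => complex.Re (f s i 0)) t 1 /\
            derivable (fun s => complex.Im (f s i 0)) t 1.

Definition cderive (R : realType) (n : nat) (f : R -> 'cV[R[i]]_n) (t : R) :
    'cV[R[i]]_n :=
  \col_i (derive1 (fun s => complex.Re (f s i 0)) t
          +i* derive1 (fun s => complex.Im (f s i 0)) t).

Definition cright_continuous (R : realType) (n : nat) (f : R -> 'cV[R[i]]_n)
    (t : R) : Prop :=
  forall i, (complex.Re (f s i 0) @[s --> t^'+] --> complex.Re (f t i 0)) /\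
            (complex.Im (f s i 0) @[s --> t^'+] --> complex.Im (f t i 0)).

(* Classical solutions on [t > 0], continuous up to [t = 0]; the values
   [W t xi] for [t < 0] are irrelevant. *)
Definition is_solution (R : realType) (a b rho theta : R)
    (W0 : 'rV[R]_2 -> 'cV[R[i]]_4) (W : R -> 'rV[R]_2 -> 'cV[R[i]]_4) : Prop :=
  forall xi : 'rV[R]_2,
  [/\ forall t : R, 0 < t ->
        cderivable (W^~ xi) t /\
        cderive (W^~ xi) t + symbol a b rho theta xi *m W t xi = 0,
      cright_continuous (W^~ xi) 0
    & W 0 xi = W0 xi].

Definition eta (R : realType) (rho theta r : R) : R :=
  r `^ (2 - 2 * rho) / (1 + r `^ (2 * theta - 2 * rho)).

(* Main.v *)
(** The system splits into the pairs (W_1, W_3) and (W_2, W_4). For a pair (u, v)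
   with B_1-entries (-m, m), put p = u + v, q = u - v, r = |xi| and
   d = (r^{2 rho} + r^{2 theta}) / 2; then p' = -2 d p + i m r q and
   q' = i m r p. Only p is damped, so |p|^2 + |q|^2 is corrected to
     L = |p|^2 + |q|^2 - 2 kap s Im (p conj(q)),  s = r / d,
   whose cross term produces damping of q. Since rho < 1/2 < theta we have
   s <= 2, so for small kap, depending only on a and b, L is equivalent to
   |p|^2 + |q|^2, and L' <= - kap m (s^2 d / 2) L, where s^2 d / 2 = eta(r). *)
Require Import Defs.
From mathcomp Require Import all_boot all_order all_algebra.
From mathcomp Require Import all_classical all_reals all_analysis.
From mathcomp Require Import ring lra.
Set Implicit Arguments.
Unset Strict Implicit.
Unset Printing Implicit Defensive.

Import Order.TTheory GRing.Theory Num.Theory.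
Import numFieldNormedType.Exports.
Local Open Scope classical_set_scope.
Local Open Scope ring_scope.

(** * Gronwall inequality up to the initial time *)

(** The product with the integrating factor [expR (k * s)] has nonpositive derivative for s > 0, and
    the right limit at 0 lets the mean value theorem reach the initial time. *)
Lemma gronwall_le (R : realType) (L dL : R -> R) (k : R) :
    (forall t : R, 0 < t -> is_derive t 1 L (dL t)) ->
    L s @[s --> 0^'+] --> L 0 ->
    (forall t : R, 0 < t -> dL t <= - k * L t) ->
  forall t : R, 0 <= t -> L t <= expR (- k * t) * L 0.
Proof.
move=> Ld L0 Lk t; rewrite le_eqVlt => /predU1P[<-|t0].
  by rewrite mulr0 expR0 mul1r.
pose g s := expR (k * s) * L s.
pose dg s := expR (k * s) * (k * L s + dL s).
have gd (s : R) : 0 < s -> is_derive s 1 g (dg s).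
  move=> s0; have Ls := Ld _ s0.
  have -> : g = (fun s => expR (k * s)) * L by [].
  apply: is_derive_eq.
  rewrite /dg /GRing.scale /=; ring.
have gc : {within `[0, t], continuous g}.
  apply/continuous_within_itvP => //; split.
  - move=> s; rewrite in_itv /= => /andP[s0 _].
    apply: differentiable_continuous; apply/derivable1_diffP.
    by have [] := gd _ s0.
  - apply: cvgM L0; apply: cvg_at_right_filter.
    by apply: continuous_comp; [exact: mulrl_continuous|exact: continuous_expR].
  - apply: cvg_at_left_filter.
    apply: differentiable_continuous; apply/derivable1_diffP.
    by have [] := gd _ t0.
have gd' s : s \in `]0, t[%R -> is_derive s 1 g (dg s).
  by rewrite in_itv /= => /andP[s0 _]; exact: gd.
have [s /[!in_itv]/= /andP[s0 _]] := MVT t0 gd' gc.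
rewrite subr0 => gE.
have : g t <= g 0.
  rewrite -subr_le0 gE mulr_le0_ge0 ?(ltW t0)// mulr_ge0_le0 ?expR_ge0//.
  by have := Lk _ s0; lra.
by rewrite /g mulr0 expR0 mul1r mulNr expRN ler_pdivlMl ?expR_gt0.
Qed.

(** * Lyapunov functional of one pair *)

(** [J] is Im (p conj(q)), and the left side of the third inequality is L' / d after substituting r
    = s d. *)
Lemma lyapunov_ineq (R : realType) (m kap s p1 p2 q1 q2 : R) :
    0 <= s -> s <= 2 -> 0 < m -> 0 < kap ->
    4 * kap <= m -> 8 * (kap * m) <= 1 -> 4 * kap <= 1 ->
  let P := p1 ^+ 2 + p2 ^+ 2 in let Q := q1 ^+ 2 + q2 ^+ 2 in
  let J := p2 * q1 - p1 * q2 in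
  [/\ P + Q <= 2 * (P + Q - 2 * (kap * s) * J),
      2 * (P + Q - 2 * (kap * s) * J) <= 3 * (P + Q) &
      - 4 * P + 4 * kap * s * J - 2 * kap * m * s ^+ 2 * (Q - P) <=
      - (kap * m * s ^+ 2 / 2) * (P + Q - 2 * (kap * s) * J)].
Proof.
move=> s0 s2 m0 k0 km km1 k1 P Q J.
have P0 : 0 <= P by rewrite addr_ge0 ?sqr_ge0.
have Q0 : 0 <= Q by rewrite addr_ge0 ?sqr_ge0.
have d0 : 0 <= kap * s by rewrite mulr_ge0 // ltW.
(* With |2 J| <= P + Q below, the cross term is at most half of P + Q. *)
have d1 : kap * s <= 2^-1 by nra.
have J1 : 2 * J <= P + Q.
  have := sqr_ge0 (p2 - q1); have := sqr_ge0 (p1 + q2).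
  by rewrite /J /P /Q; nra.
have J2 : - (P + Q) <= 2 * J.
  have := sqr_ge0 (p2 + q1); have := sqr_ge0 (p1 - q2).
  by rewrite /J /P /Q; nra.
have L1 : 2 * (P + Q - 2 * (kap * s) * J) <= 3 * (P + Q) by nra.
split => //; first by nra.
have y0 : 0 <= kap * m * s ^+ 2 by rewrite mulr_ge0 ?sqr_ge0// mulr_ge0// ltW.
have y1 : kap * m * s ^+ 2 <= 2^-1.
  have : s ^+ 2 <= 4 by nra.
  have : 0 < kap * m by rewrite mulr_gt0.
  by have := sqr_ge0 s; nra.
(* |p - 2 kap s i q|^2 >= 0 and 4 kap <= m *)
have J3 : 4 * kap * s * J <= P + kap * m * s ^+ 2 * Q.
  have : 4 * kap * s * J <= P + 4 * kap * kap * s ^+ 2 * Q.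
    have := sqr_ge0 (p2 - 2 * (kap * s) * q1).
    have := sqr_ge0 (p1 + 2 * (kap * s) * q2).
    by rewrite /J /P /Q; lra.
  move=> /le_trans; apply; rewrite lerD2l ler_wpM2r// ler_wpM2r ?sqr_ge0//.
  by rewrite mulrC ler_wpM2l// ltW.
(* By [J3] and 2 y <= 1 the left side is at most - 2 P - y Q, while [L1] gives (y / 2) L <= (3 / 4)
   y (P + Q). *)
have := mulr_ge0 y0 P0; have := mulr_ge0 y0 Q0.
move: y0 y1 J3 L1.
set y := kap * m * s ^+ 2; set L := P + Q - _.
have -> : 2 * kap * m * s ^+ 2 = 2 * y by rewrite /y; ring.
by nra.
Qed.

(** Here [al] is d, and r is written [s * al], so that no division occurs and d = 0 is covered. *)
Lemma pair_decay (R : realType) (al m kap s : R) (p1 p2 q1 q2 : R -> R) :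
    0 <= al -> 0 <= s -> s <= 2 -> 0 < m -> 0 < kap ->
    4 * kap <= m -> 8 * (kap * m) <= 1 -> 4 * kap <= 1 ->
    (forall t : R, 0 < t ->
      [/\ is_derive t 1 p1 (- (2 * al) * p1 t - m * (s * al) * q2 t),
          is_derive t 1 p2 (- (2 * al) * p2 t + m * (s * al) * q1 t),
          is_derive t 1 q1 (- (m * (s * al)) * p2 t) &
          is_derive t 1 q2 (m * (s * al) * p1 t)]) ->
    [/\ p1 t @[t --> 0^'+] --> p1 0, p2 t @[t --> 0^'+] --> p2 0,
        q1 t @[t --> 0^'+] --> q1 0 & q2 t @[t --> 0^'+] --> q2 0] ->
  let E t := p1 t ^+ 2 + p2 t ^+ 2 + (q1 t ^+ 2 + q2 t ^+ 2) in
  forall t : R, 0 <= t ->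
    E t <= 3 * expR (- (kap * m * (s ^+ 2 * al / 2)) * t) * E 0.
Proof.
move=> al0 s0 s2 m0 k0 km km1 k1 d [p10 p20 q10 q20] E t t0.
have I x := lyapunov_ineq (p1 x) (p2 x) (q1 x) (q2 x) s0 s2 m0 k0 km km1 k1.
pose L x := p1 x ^+ 2 + p2 x ^+ 2 + (q1 x ^+ 2 + q2 x ^+ 2) -
  2 * (kap * s) * (p2 x * q1 x - p1 x * q2 x).
pose dL x := al * (- 4 * (p1 x ^+ 2 + p2 x ^+ 2) +
  4 * kap * s * (p2 x * q1 x - p1 x * q2 x) -
  2 * kap * m * s ^+ 2 * ((q1 x ^+ 2 + q2 x ^+ 2) - (p1 x ^+ 2 + p2 x ^+ 2))).
have Ld (x : R) : 0 < x -> is_derive x 1 L (dL x).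
  move=> x0; have [P1 P2 Q1 Q2] := d _ x0.
  have -> : L = p1 ^+ 2 + p2 ^+ 2 + (q1 ^+ 2 + q2 ^+ 2) -
    (2 * (kap * s)) \*: (p2 * q1 - p1 * q2).
    by apply/funext => y; rewrite /L.
  have /is_derive_eq := is_deriveB
    (is_deriveD (is_deriveD (is_deriveX 2 P1) (is_deriveX 2 P2))
                (is_deriveD (is_deriveX 2 Q1) (is_deriveX 2 Q2)))
    (is_deriveZ (2 * (kap * s))
                (is_deriveB (is_deriveM P2 Q1) (is_deriveM P1 Q2))).
  by apply; rewrite /dL /GRing.scale /=; ring.
have L0 : L x @[x --> 0^'+] --> L 0.
  by apply: cvgB; [apply: cvgD; apply: cvgD; apply: cvgM|
    apply: cvgM; [exact: cvg_cst|apply: cvgB; apply: cvgM]].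
have LL := gronwall_le (k := kap * m * (s ^+ 2 * al / 2)) Ld L0 _ t0.
have [It _ _] := I t; have [_ I0 _] := I 0.
(* The constant 3 comes from E(t) <= 2 L(t) <= 2 e L(0) <= 3 e E(0), with e the exponential
   factor. *)
apply: (le_trans It).
apply: (@le_trans _ _ (2 * (expR (- (kap * m * (s ^+ 2 * al / 2)) * t) * L 0))).
  rewrite ler_pM2l//; apply: LL => x x0.
  have [_ _ Ix] := I x.
  have := ler_wpM2l al0 Ix; rewrite -/(L x).
  rewrite -/(dL x) => /le_trans; apply.
  by rewrite le_eqVlt; apply/orP; left; apply/eqP; field.
by rewrite mulrCA [leRHS]mulrAC [leRHS]mulrC ler_wpM2l ?expR_ge0.
Qed.

(** * The symbol, its damping and the coupled components *)

Section Symbol.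
Context {R : realType}.
Implicit Types (a b rho theta r t : R) (xi : 'rV[R]_2).

Lemma enorm_ge0 n (x : 'rV[R]_n) : 0 <= enorm x.
Proof. exact: sqrtr_ge0. Qed.

(** The total coefficient d of B_0 in the symbol. *)
Definition damping rho theta r : R :=
  2^-1 * (r `^ (2 * rho) + r `^ (2 * theta)).

Lemma damping_ge0 rho theta r : 0 <= damping rho theta r.
Proof. by rewrite mulr_ge0 ?invr_ge0// addr_ge0// powR_ge0. Qed.

(** The low power dominates r for r <= 1, the high power for r >= 1; this yields s <= 2. *)
Lemma le_damping rho theta r :
  rho < 2^-1 -> 2^-1 < theta -> 0 <= r -> r <= 2 * damping rho theta r.
Proof.
move=> hr ht; rewrite /damping mulrA divff ?mul1r ?pnatr_eq0// le_eqVlt.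
case/predU1P => [<-|r0]; first by rewrite addr_ge0// powR_ge0.
have [r1|r1] := leP r 1.
  apply: (@le_trans _ _ (r `^ (2 * rho))); last by rewrite lerDl powR_ge0.
  by apply: ger1_powR; [rewrite r0|lra].
apply: (@le_trans _ _ (r `^ (2 * theta))); last by rewrite lerDr powR_ge0.
by apply: le1r_powR; [exact: ltW|lra].
Qed.

Lemma damping_gt0 rho theta r : 0 < r -> 0 < damping rho theta r.
Proof. by move=> r0; rewrite mulr_gt0 ?invr_gt0// addr_gt0// powR_gt0. Qed.

Lemma divfK_damping rho theta r : rho < 2^-1 -> 2^-1 < theta -> 0 <= r ->
  r / damping rho theta r * damping rho theta r = r.
Proof.
move=> hr ht; rewrite le_eqVlt => /predU1P[<-|r0]; first by rewrite !mul0r.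
by rewrite divfK// gt_eqF// damping_gt0.
Qed.

(** For r > 0 both sides equal r^2 / (r^{2 rho} + r^{2 theta}). *)
Lemma etaE rho theta r : rho < 2^-1 -> 2^-1 < theta -> 0 <= r ->
  eta rho theta r =
  (r / damping rho theta r) ^+ 2 * damping rho theta r / 2.
Proof.
move=> hr ht; rewrite le_eqVlt => /predU1P[<-|r0].
  (* At r = 0 the numerator of [eta] vanishes because 2 - 2 rho is nonzero. *)
  by rewrite /eta powR0 ?mul0r ?expr0n/= ?mul0r//; apply/eqP; lra.
have rn0 : r != 0 by rewrite gt_eqF.
rewrite /eta !powRB ?rn0 ?implybT// (powR_mulrn 2) ?(ltW r0)// /damping.
have := powR_gt0 (2 * rho) r0; have := powR_gt0 (2 * theta) r0.
set x := r `^ _; set y := r `^ _ => x0 y0.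
by field; rewrite !gt_eqF// addr_gt0.
Qed.

(* Addition in ['I_4] is modulo 4, so [i + 2] is the index coupled to [i] by
   [B0]. *)
Lemma symbol_mulE a b rho theta xi (v : 'cV[R[i]%C]_4) (i : 'I_4) :
  (symbol a b rho theta xi *m v) i 0 =
    (damping rho theta (enorm xi))%:C%C * (v i 0 + v (i + 2) 0) +
    'i%C * (enorm xi * [:: - b; - a; b; a]`_i)%:C%C * v i 0.
Proof.
pose w k := v (inord k) 0.
have vE j : v j 0 = w (val j) by rewrite /w inord_val.
rewrite mxE !big_ord_recl big_ord0 !mxE !vE /damping.
rewrite !(mulrDr, rmorphD, rmorphM).
by case: i => [[|[|[|[|//]]]] ilt] /=;
  rewrite ?rmorph0 ?rmorph1 ?mulr0n ?mulr1n; ring.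
Qed.

Lemma solution_is_derive a b rho theta W0 W xi t (i : 'I_4) :
    is_solution a b rho theta W0 W -> 0 < t ->
  let d := damping rho theta (enorm xi) in
  let mu := enorm xi * [:: - b; - a; b; a]`_i in
  is_derive t 1 (fun s => complex.Re (W s xi i 0))
    (- d * (complex.Re (W t xi i 0) + complex.Re (W t xi (i + 2) 0)) +
     mu * complex.Im (W t xi i 0)) /\
  is_derive t 1 (fun s => complex.Im (W s xi i 0))
    (- d * (complex.Im (W t xi i 0) + complex.Im (W t xi (i + 2) 0)) -
     mu * complex.Re (W t xi i 0)).
Proof.
move=> /(_ xi)[+ _ _] t0 d mu => /(_ _ t0)[/(_ i)[dRe dIm]].
move=> /matrixP/(_ i 0); rewrite mxE symbol_mulE !mxE -/d -/mu !derive1E.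
case: (W t xi i 0) => x y; case: (W t xi (i + 2) 0) => x' y' /=.
move=> [eRe eIm].
by split; apply: DeriveDef => //; lra.
Qed.

Definition sqrmod (z : R[i]%C) : R := complex.Re z ^+ 2 + complex.Im z ^+ 2.

Lemma sqrmod_ge0 z : 0 <= sqrmod z.
Proof. by rewrite addr_ge0 ?sqr_ge0. Qed.

(** Sum and difference of components [i] and [i + 2] satisfy the real system of [pair_decay]; [i] is
    the index with B_1-entry -m. *)
Lemma solution_pair_decay a b rho theta W0 W xi t kap m (i : 'I_4) :
    is_solution a b rho theta W0 W ->
    rho < 2^-1 -> 2^-1 < theta ->
    [:: - b; - a; b; a]`_i = - m -> [:: - b; - a; b; a]`_(i + 2)%R = m ->
    0 < m -> 0 < kap -> 4 * kap <= m -> 8 * (kap * m) <= 1 -> 4 * kap <= 1 ->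
    0 <= t ->
  sqrmod (W t xi i 0) + sqrmod (W t xi (i + 2) 0) <=
  3 * expR (- (kap * m * eta rho theta (enorm xi)) * t) *
  (sqrmod (W 0 xi i 0) + sqrmod (W 0 xi (i + 2) 0)).
Proof.
move=> sol hr ht mi mi2 m0 k0 km km1 k1 t0.
have r0 := enorm_ge0 xi.
set r := enorm xi in r0 *; set d := damping rho theta r.
have d0 : 0 <= d := damping_ge0 rho theta r.
have sd : r / d * d = r by exact: divfK_damping.
have s2 : r / d <= 2.
  (* If d = 0, the quotient is 0 by the convention on division by zero. *)
  have [->|dn0] := eqVneq d 0; first by rewrite invr0 mulr0.
  by rewrite ler_pdivrMr ?lt_def ?dn0//; exact: le_damping.
have s0 : 0 <= r / d by exact: divr_ge0.
pose p1 s := complex.Re (W s xi i 0) + complex.Re (W s xi (i + 2) 0).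
pose p2 s := complex.Im (W s xi i 0) + complex.Im (W s xi (i + 2) 0).
pose q1 s := complex.Re (W s xi i 0) - complex.Re (W s xi (i + 2) 0).
pose q2 s := complex.Im (W s xi i 0) - complex.Im (W s xi (i + 2) 0).
(* Modulo 4 the coupling is symmetric: the partner of [i + 2] is [i]. *)
have i4 : i + 2 + 2 = i.
  by apply/val_inj; case: i {mi mi2 p1 p2 q1 q2} => [[|[|[|[|//]]]] ilt].
have der (s : R) : 0 < s ->
    [/\ is_derive s 1 p1 (- (2 * d) * p1 s - m * (r / d * d) * q2 s),
        is_derive s 1 p2 (- (2 * d) * p2 s + m * (r / d * d) * q1 s),
        is_derive s 1 q1 (- (m * (r / d * d)) * p2 s) &
        is_derive s 1 q2 (m * (r / d * d) * p1 s)].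
  move=> s_gt0; rewrite sd.
  have [u1 u2] := solution_is_derive xi i sol s_gt0.
  have [v1 v2] := solution_is_derive xi (i + 2) sol s_gt0.
  rewrite -/r -/d mi ?mi2 ?i4 in u1 u2 v1 v2.
  split.
  - by have /is_derive_eq := is_deriveD u1 v1; apply; rewrite /p1 /q2; ring.
  - by have /is_derive_eq := is_deriveD u2 v2; apply; rewrite /p2 /q1; ring.
  - by have /is_derive_eq := is_deriveB u1 v1; apply; rewrite /p2; ring.
  - by have /is_derive_eq := is_deriveB u2 v2; apply; rewrite /p1; ring.
have [_ cont _] := sol xi.
have [c1 c2] := cont i; have [c3 c4] := cont (i + 2).
have cvg0 : [/\ p1 s @[s --> 0^'+] --> p1 0, p2 s @[s --> 0^'+] --> p2 0,
    q1 s @[s --> 0^'+] --> q1 0 & q2 s @[s --> 0^'+] --> q2 0].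
  by split; [exact: cvgD|exact: cvgD|exact: cvgB|exact: cvgB].
have := pair_decay d0 s0 s2 m0 k0 km km1 k1 der cvg0 t0.
rewrite -etaE// /=.
set e := expR _.
(* Parallelogram law; the factor 2 cancels between times t and 0. *)
have E s : p1 s ^+ 2 + p2 s ^+ 2 + (q1 s ^+ 2 + q2 s ^+ 2) =
    2 * (sqrmod (W s xi i 0) + sqrmod (W s xi (i + 2) 0)).
  by rewrite /p1 /p2 /q1 /q2 /sqrmod; ring.
by rewrite !E mulrCA ler_pM2l.
Qed.
End Symbol.

(** * Choice of constants and recombination of the two pairs *)

Theorem proposition3p1 (R : realType) (a b rho theta : R)
    (ha : 0 < a) (hab : a < b)
    (hrho0 : 0 <= rho) (hrho : rho < 2^-1)
    (htheta : 2^-1 < theta) (htheta1 : theta <= 1) :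
  exists C c : R, [/\ 0 < C, 0 < c &
    forall (W0 : 'rV[R]_2 -> 'cV[R[i]%C]_4) (W : R -> 'rV[R]_2 -> 'cV[R[i]%C]_4),
      is_solution a b rho theta W0 W ->
      forall (xi : 'rV[R]_2) (t : R), 0 <= t ->
        hnorm (W t xi) <= C * expR (- c * eta rho theta (enorm xi) * t) * hnorm (W0 xi)].
Proof.
have b0 : 0 < b := lt_trans ha hab.
have b80 : 0 < 8 * b by rewrite mulr_gt0.
(* The three entries give the three smallness conditions, for m = a and m = b alike since a < b. *)
pose kap := Num.min (a / 4) (Num.min (8 * b)^-1 4^-1).
have k0 : 0 < kap by rewrite !lt_min divr_gt0// !invr_gt0 b80/=.
have ka : 4 * kap <= a by rewrite mulrC -ler_pdivlMr// /kap !ge_min lexx.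
have kb : 8 * (kap * b) <= 1.
  by rewrite mulrCA -ler_pdivlMr// div1r /kap !ge_min lexx orbT.
have k1 : 4 * kap <= 1.
  by rewrite mulrC -ler_pdivlMr// div1r /kap !ge_min lexx !orbT.
(* The squared norms decay with constant 3 <= 2^2 and rate kap a eta; the square root halves the
   rate. *)
exists 2, (kap * a / 2); split => //; first by rewrite !mulr_gt0.
move=> W0 W sol xi t t0; have [_ _ <-] := sol xi.
set h := eta _ _ _.
have h0 : 0 <= h by rewrite divr_ge0 ?addr_ge0 ?powR_ge0.
pose N s j := sqrmod (W s xi j 0).
have hE s : hnorm (W s xi) = Num.sqrt (N s 0 + N s 2 + (N s 1 + N s 3)).
  rewrite /hnorm !big_ord_recl big_ord0 addr0; congr Num.sqrt.
  rewrite (_ : lift ord0 (lift ord0 (lift ord0 ord0)) = 3); last exact/val_inj.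
  rewrite (_ : lift ord0 (lift ord0 ord0) = 2); last exact/val_inj.
  rewrite (_ : lift ord0 ord0 = 1); last exact/val_inj.
  by rewrite /N /sqrmod; ring.
have D2 := solution_pair_decay (i := 0) xi sol hrho htheta erefl erefl
  b0 k0 (le_trans ka (ltW hab)) kb k1 t0.
have ka1 : 8 * (kap * a) <= 1.
  by apply: le_trans kb; rewrite ler_pM2l// ler_pM2l// ltW.
have D1 := solution_pair_decay (i := 1) xi sol hrho htheta erefl erefl
  ha k0 ka ka1 k1 t0.
rewrite add0r -/(N t 0) -/(N t 2) -/(N 0 0) -/(N 0 2) -/h in D2.
rewrite (_ : 1 + 2 = 3 :> 'I_4) in D1; last exact/val_inj.
rewrite -/(N t 1) -/(N t 3) -/(N 0 1) -/(N 0 3) -/h in D1.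
set e := expR _; have e0 : 0 <= e := expR_ge0 _.
have eE : expR (- (kap * a * h) * t) = e ^+ 2.
  by rewrite /e -expRM_natl; congr expR; field.
(* The pair with m = b decays at least as fast, so the rate of the pair with m = a serves both. *)
have eb : expR (- (kap * b * h) * t) <= e ^+ 2.
  rewrite -eE ler_expR !mulNr lerN2 ler_wpM2r// ler_wpM2r// ler_pM2l//.
  exact: ltW.
rewrite !hE.
have NN0 s i j : 0 <= N s i + N s j by rewrite addr_ge0// sqrmod_ge0.
have -> : 2 * e = Num.sqrt (4 * e ^+ 2).
  rewrite (_ : 4 * e ^+ 2 = (2 * e) ^+ 2); last by ring.
  by rewrite sqrtr_sqr ger0_norm// mulr_ge0.
rewrite -sqrtrM ?mulr_ge0 ?sqr_ge0// ler_sqrt; last first.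
  exact: mulr_ge0 (mulr_ge0 _ (sqr_ge0 _)) (addr_ge0 (NN0 _ _ _) (NN0 _ _ _)).
rewrite [leRHS]mulrDr lerD//.
  apply: (le_trans D2); rewrite ler_wpM2r ?NN0//.
  by have := expR_ge0 (- (kap * b * h) * t); lra.
apply: (le_trans D1); rewrite eE ler_wpM2r ?NN0//.
by have := sqr_ge0 e; lra.
Qed.
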